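(* Let $f_0,f_1:\mathbb{R}^n\to\mathbb{R}\cup\{\infty\}$ be proper, lower semicontinuous, convex functions, and let $PA_{f_0,f_1}$ be their proximal average, $$PA_{f_0,f_1}(x,\lambda):=\Big((1-\lambda)\big(f_0+\tfrac12|\cdot|^2\big)^*+\lambda\big(f_1+\tfrac12|\cdot|^2\big)^*\Big)^*(x)-\tfrac12|x|^2,\qquad\lambda\in[0,1].$$ Then for every $\bar\lambda\in(0,1)$, $PA_{f_0,f_1}$ is para-prox-regular in $x$ with compatible parametrization by $\lambda$ at $\bar\lambda$; that is, for every $\bar x$ with $PA_{f_0,f_1}(\bar x,\bar\lambda)<\infty$ and every $\bar v\in\partial_xPA_{f_0,f_1}(\bar x,\bar\lambda)$, it is para-prox-regular in $x$ at $\bar x$ for $\bar v$ with compatible parametrization by $\lambda$ at $\bar\lambda$ (for some parameters).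
   Context: $|\cdot|$ is the Euclidean norm. The Fenchel conjugate of a proper function $h$ is $h^*(y)=\sup_x\{\langle x,y\rangle-h(x)\}$. Subgradients: for $h:\mathbb{R}^n\to\mathbb{R}\cup\{\infty\}$ and $x\in\operatorname{dom}h$, $v\in\hat\partial h(x)$ (regular subgradient) if $h(y)\ge h(x)+\langle v,y-x\rangle+o(|y-x|)$; $v\in\partial h(x)$ (subgradient) if there are $x^\nu\to x$ with $h(x^\nu)\to h(x)$ and $v^\nu\in\hat\partial h(x^\nu)$ with $v^\nu\to v$. For a function $f(x,\lambda)$, $\partial_xf(x,\lambda)$ is the subdifferential of $f(\cdot,\lambda)$ at $x$. A function $h$ finite at $\bar w$ is locally lsc (lower semicontinuous) at $\bar w$ if there is $\epsilon>0$ such that all sets $\{w:|w-\bar w|\le\epsilon,\ h(w)\le\alpha\}$ with $\alpha\le h(\bar w)+\epsilon$ are closed. A proper $f$ of $(x,\lambda)$ is para-prox-regular in $x$ at $\bar x$ for $\bar v$ with compatible parametrization by $\lambda$ at $\bar\lambda$, with parameters $\epsilon>0$, $r\ge0$, if $f$ is locally lsc at $(\bar x,\bar\lambda)$, $\bar v\in\partial_xf(\bar x,\bar\lambda)$, and $f(x',\lambda)\ge f(x,\lambda)+\langle v,x'-x\rangle-\frac r2|x'-x|^2$ whenever $|x'-\bar x|<\epsilon$, $|x-\bar x|<\epsilon$, $|f(x,\lambda)-f(\bar x,\bar\lambda)|<\epsilon$, $v\in\partial_xf(x,\lambda)$, $|v-\bar v|<\epsilon$ and $|\lambda-\bar\lambda|<\epsilon$.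 Here $\lambda$ is a real parameter near $\bar\lambda\in(0,1)$, and $\epsilon$ may be taken small enough that all $\lambda$ involved lie in $(0,1)$. *)

(* Defs.v *)
From HB Require Import structures.
From mathcomp Require Import all_boot all_order all_algebra.
From mathcomp Require Import all_classical all_reals all_analysis.

Set Implicit Arguments.
Unset Strict Implicit.
Unset Printing Implicit Defensive.

Import Order.TTheory GRing.Theory Num.Theory.
Import numFieldNormedType.Exports.

Local Open Scope classical_set_scope.
Local Open Scope ring_scope.
Local Open Scope ereal_scope.

(* R^n is 'rV[R]_n. The library's norm on matrices is the max norm, so the
   Euclidean norm is defined here; both induce the library's topology. *)
Definition dotv (R : realType) (n : nat) (x y : 'rV[R]_n) : R :=
  (\sum_(i < n) x ord0 i * y ord0 i)%R.

Definition enorm (R : realType) (n : nat) (x : 'rV[R]_n) : R :=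
  Num.sqrt (dotv x x).

(* The Euclidean norm of R^(n+1), identified with R^n * R. *)
Definition enorm_pair (R : realType) (n : nat) (w : 'rV[R]_n * R) : R :=
  Num.sqrt (enorm w.1 ^+ 2 + w.2 ^+ 2)%R.

Definition proper_fun (R : realType) (T : Type) (h : T -> \bar R) : Prop :=
  (forall x, h x != -oo) /\ (exists x, h x < +oo).

Definition econvex (R : realType) (n : nat) (h : 'rV[R]_n -> \bar R) : Prop :=
  forall (x y : 'rV[R]_n) (t : R), (0 <= t <= 1)%R ->
    h ((1 - t) *: x + t *: y)%R <= (1 - t)%:E * h x + t%:E * h y.

Definition fenchel (R : realType) (n : nat) (h : 'rV[R]_n -> \bar R)
    (y : 'rV[R]_n) : \bar R :=
  ereal_sup [set (dotv x y)%:E - h x | x in [set: 'rV[R]_n]].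

Definition regular_subgradient (R : realType) (n : nat)
    (h : 'rV[R]_n -> \bar R) (x v : 'rV[R]_n) : Prop :=
  h x \is a fin_num /\
  exists2 o : 'rV[R]_n -> R,
    o =o_x (fun y => enorm (y - x)%R) &
    \forall y \near x, h x + (dotv v (y - x)%R + o y)%:E <= h y.

Definition subgradient (R : realType) (n : nat)
    (h : 'rV[R]_n -> \bar R) (x v : 'rV[R]_n) : Prop :=
  h x \is a fin_num /\
  exists xs vs : nat -> 'rV[R]_n,
    [/\ xs k @[k --> \oo] --> x, h (xs k) @[k --> \oo] --> h x,
        forall k, regular_subgradient h (xs k) (vs k) &
        vs k @[k --> \oo] --> v].

Definition locally_lsc (R : realType) (n : nat)
    (h : 'rV[R]_n * R -> \bar R) (w : 'rV[R]_n * R) : Prop :=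
  h w \is a fin_num /\
  exists2 eps : R, (0 < eps)%R &
    forall a : R, a%:E <= h w + eps%:E ->
      closed [set u : 'rV[R]_n * R |
                (enorm_pair (u - w) <= eps)%R /\ h u <= a%:E].

Definition para_prox_regular_with (R : realType) (n : nat)
    (f : 'rV[R]_n * R -> \bar R) (xbar vbar : 'rV[R]_n) (lbar : R)
    (eps r : R) : Prop :=
  [/\ proper_fun f,
      locally_lsc f (xbar, lbar),
      subgradient (fun x => f (x, lbar)) xbar vbar &
      forall (x' x v : 'rV[R]_n) (l : R),
        (enorm (x' - xbar) < eps)%R ->
        (enorm (x - xbar) < eps)%R ->
        `| f (x, l) - f (xbar, lbar) | < eps%:E ->
        subgradient (fun y => f (y, l)) x v ->
        (enorm (v - vbar) < eps)%R ->
        (`| l - lbar | < eps)%R ->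
        f (x, l) + (dotv v (x' - x)%R - r / 2 * enorm (x' - x) ^+ 2)%:E
          <= f (x', l)].

Definition para_prox_regular (R : realType) (n : nat)
    (f : 'rV[R]_n * R -> \bar R) (xbar vbar : 'rV[R]_n) (lbar : R) : Prop :=
  exists eps r : R, [/\ (0 < eps)%R, (0 <= r)%R &
    para_prox_regular_with f xbar vbar lbar eps r].

Definition half_sqnorm (R : realType) (n : nat) (x : 'rV[R]_n) : R :=
  (2^-1 * enorm x ^+ 2)%R.

(* The proximal average is a function on R^n * [0, 1]; as usual in variational
   analysis it is extended by +oo to the parameters outside [0, 1]. *)
Definition prox_average (R : realType) (n : nat) (f0 f1 : 'rV[R]_n -> \bar R)
    (w : 'rV[R]_n * R) : \bar R :=
  let: (x, l) := w in
  if (0 <= l <= 1)%R then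
    fenchel (fun y =>
      (1 - l)%:E * fenchel (fun z => f0 z + (half_sqnorm z)%:E) y
      + l%:E * fenchel (fun z => f1 z + (half_sqnorm z)%:E) y) x
    - (half_sqnorm x)%:E
  else +oo.

(* Main.v *)
(* For fixed [l] in [0, 1], adding [half_sqnorm] to the proximal average gives a
   Fenchel conjugate, i.e. a supremum of affine functions.  Convexity of this sum
   turns the first-order inequality of a regular subgradient into the global
   proximal inequality with constant [r = 1], which passes to limiting
   subgradients.  Jointly in [(x, l)] with 0 < l < 1, the proximal average is a
   supremum of continuous functions, hence lower semicontinuous.  Properness
   follows from finiteness at [(xbar, lbar)]: it provides a point where both
   conjugates are finite. *)
Require Import Defs.
From HB Require Import structures.
From mathcomp Require Import all_boot all_order all_algebra.
From mathcomp Require Import all_classical all_reals all_analysis.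
From mathcomp Require Import ring lra.

Set Implicit Arguments.
Unset Strict Implicit.
Unset Printing Implicit Defensive.

Import Order.TTheory GRing.Theory Num.Theory.
Import numFieldNormedType.Exports.

Local Open Scope classical_set_scope.
Local Open Scope ring_scope.
Local Open Scope ereal_scope.

(** * Euclidean inner product and norm, and their continuity *)

Section EuclideanSpace.
Context {R : realType} {n : nat}.
Implicit Types x y z v : 'rV[R]_n.
Local Open Scope ring_scope.

Lemma dotvC x y : dotv x y = dotv y x.
Proof. by apply: eq_bigr => i _; rewrite mulrC. Qed.

Lemma dotvDl x y z : dotv (x + y) z = dotv x z + dotv y z.
Proof. by rewrite -big_split; apply: eq_bigr => i _; rewrite mxE mulrDl. Qed.

Lemma dotvZl t x y : dotv (t *: x) y = t * dotv x y.
Proof. by rewrite mulr_sumr; apply: eq_bigr => i _; rewrite mxE mulrA. Qed.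

Lemma dotvDr x y z : dotv x (y + z) = dotv x y + dotv x z.
Proof. by rewrite dotvC dotvDl !(dotvC x). Qed.

Lemma dotvZr t x y : dotv x (t *: y) = t * dotv x y.
Proof. by rewrite dotvC dotvZl dotvC. Qed.

Lemma sqr_enorm x : enorm x ^+ 2 = dotv x x.
Proof. by rewrite sqr_sqrtr // sumr_ge0 // => i _; rewrite -expr2 sqr_ge0. Qed.

Lemma enorm_ge0 x : 0 <= enorm x.
Proof. exact: sqrtr_ge0. Qed.

Lemma enormZ t x : 0 <= t -> enorm (t *: x) = t * enorm x.
Proof.
move=> t0; rewrite /enorm dotvZl dotvZr mulrA -expr2 sqrtrM ?sqr_ge0 //.
by rewrite sqrtr_sqr ger0_norm.
Qed.

Lemma half_sqnorm_ge0 x : 0 <= half_sqnorm x.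
Proof. by rewrite mulr_ge0 ?invr_ge0 // sqr_ge0. Qed.

Lemma half_sqnormD x y :
  half_sqnorm (x + y) = half_sqnorm x + dotv x y + half_sqnorm y.
Proof.
rewrite /half_sqnorm !sqr_enorm dotvDl !dotvDr (dotvC y x); lra.
Qed.

Lemma half_sqnormZ t x : half_sqnorm (t *: x) = t ^+ 2 * half_sqnorm x.
Proof. by rewrite /half_sqnorm !sqr_enorm dotvZl dotvZr; ring. Qed.

Lemma cvg_dotv {T : Type} {F : set_system T} {FF : Filter F}
    (f g : T -> 'rV[R]_n) x y :
  f t @[t --> F] --> x -> g t @[t --> F] --> y ->
  dotv (f t) (g t) @[t --> F] --> dotv x y.
Proof.
move=> fx gy; apply: cvg_big => [|i _]; first exact: add_continuous.
have coord (u : T -> 'rV[R]_n) z :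
    u t @[t --> F] --> z -> u t ord0 i @[t --> F] --> z ord0 i.
  exact: continuous_cvg (@coord_continuous R 1 n ord0 i z).
by apply: cvgM; exact: coord.
Qed.

Lemma cvg_half_sqnorm {T : Type} {F : set_system T} {FF : Filter F}
    (f : T -> 'rV[R]_n) x :
  f t @[t --> F] --> x -> half_sqnorm (f t) @[t --> F] --> half_sqnorm x.
Proof.
move=> fx; rewrite /half_sqnorm sqr_enorm.
under eq_fun do rewrite sqr_enorm.
by apply: cvgM; [exact: cvg_cst | exact: cvg_dotv].
Qed.

Lemma continuous_enorm_pair : continuous (@enorm_pair R n).
Proof.
move=> w; apply: continuous_cvg; first exact: sqrt_continuous.
rewrite sqr_enorm; under eq_fun do rewrite sqr_enorm.
apply: cvgD; first by apply: cvg_dotv; exact: cvg_fst.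
by apply: cvgM; exact: cvg_snd.
Qed.

(** Turns closeness of pairs in the Euclidean norm into closeness of their parameters. *)
Lemma norm_snd_le_enorm_pair (w : 'rV[R]_n * R) : `|w.2| <= enorm_pair w.
Proof.
by rewrite -sqrtr_sqr ler_wsqrtr // lerDr sqr_ge0.
Qed.

(** This Euclidean ball is not a ball of the library norm; it is closed as the preimage of a
    half-line under a continuous function. *)
Lemma closed_enorm_pair_ball (w : 'rV[R]_n * R) (eps : R) :
  closed [set u : 'rV[R]_n * R | enorm_pair (u - w) <= eps].
Proof.
have c : continuous (fun u : 'rV[R]_n * R => enorm_pair (u - w)).
  move=> u; apply: continuous_cvg; first exact: continuous_enorm_pair.
  by apply: cvgB; [exact: cvg_id | exact: cvg_cst].
by have := iffLR (continuous_closedP _) c _ (@closed_le R eps); apply.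
Qed.

End EuclideanSpace.

(** * Convexity of conjugates and the proximal inequality for subgradients *)

Section Subgradients.
Context {R : realType} {n : nat}.
Implicit Types (h : 'rV[R]_n -> \bar R) (x y v : 'rV[R]_n).

Lemma fenchel_ge h x z : (dotv z x)%:E - h z <= fenchel h x.
Proof. by apply: ereal_sup_ubound; exists z. Qed.

Lemma fenchel_econvex h : econvex (fenchel h).
Proof.
move=> x y t /andP[t0 t1]; have s0 : (0 <= 1 - t)%R by rewrite subr_ge0.
apply: ge_ereal_sup => _ [z _ <-].
case hz: (h z) => [a| |]; rewrite /= ?leNye //.
  rewrite (_ : (dotv z ((1 - t) *: x + t *: y))%:E - a%:E =
    (1 - t)%:E * ((dotv z x)%:E - h z) + t%:E * ((dotv z y)%:E - h z)).
    by apply: leeD; apply: lee_wpmul2l; rewrite ?lee_fin //; exact: fenchel_ge.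
  by rewrite hz dotvDr !dotvZr -!EFinB -!EFinM -EFinD; congr EFin; ring.
(* Here [h z] is -oo, which makes the conjugate, and hence the right-hand side, +oo. *)
have infty w : fenchel h w = +oo.
  by apply/eqP; rewrite -leye_eq (le_trans _ (fenchel_ge h w z)) // hz.
rewrite !infty.
have [->|tN0] := eqVneq t 0%R; first by rewrite subr0 mul1e mul0e leey.
have tp : (0 < t)%R by rewrite lt0r tN0.
by rewrite -ge0_muleDl ?lee_fin // -EFinD subrK mul1e leey.
Qed.

(** On the segment [x + t *: d] with [d = x' - x], convexity bounds [h] from above, and the regular
    subgradient bounds it from below up to o(t). In the comparison the quadratic terms reduce to
    [(t - t ^+ 2) * half_sqnorm d]; dividing by a small [t] gives the claim up to any [e > 0]. *)
Lemma regular_subgradient_prox_ineq h x v x' :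
  (forall y, h y != -oo) -> econvex (fun y => h y + (half_sqnorm y)%:E) ->
  regular_subgradient h x v ->
  h x + (dotv v (x' - x) - half_sqnorm (x' - x))%:E <= h x'.
Proof.
move=> hNy hcvx [hx [w wE hge]].
case hx': (h x') (hNy x') => [a| |] // _; last by rewrite leey.
move: hx hge; case hx: (h x) => [b| |] // _ hge.
rewrite -EFinD lee_fin; apply/ler_addgt0Pr => e e0.
set d := (x' - x)%R.
have d1_gt0 : (0 < enorm d + 1)%R by rewrite ltr_wpDl // enorm_ge0.
have xtx : (x + t *: d)%R @[t --> 0%R^'+] --> x.
  apply: cvg_at_right_filter; rewrite -[X in _ --> X]addr0 -(scale0r d).
  by apply: cvgD; [exact: cvg_cst | apply: cvgZ; [exact: cvg_id | exact: cvg_cst]].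
(* The tolerance [e / (enorm d + 1)] makes the error at most [t * e]; the added 1 avoids division by
   zero when [x' = x]. *)
have : \forall t \near (0 : R)%R^'+, [/\ (0 < t)%R, (t < 1)%R,
    (`|w (x + t *: d)| <= e / (enorm d + 1) * `|enorm (x + t *: d - x)|)%R &
    (b%:E + (dotv v (x + t *: d - x) + w (x + t *: d)%R)%:E
       <= h (x + t *: d)%R)].
  near=> t; split.
  - by near: t; exact: nbhs_right_gt.
  - by near: t; exact: nbhs_right_lt.
  - near: t; apply: (xtx (fun y => (`|w y| <= _ * `|enorm (y - x)|)%R)).
    by move/eqoP : wE; apply; rewrite divr_gt0.
  - by near: t; exact: (xtx (fun y => b%:E + (dotv v (y - x) + w y)%:E <= h y)).
move=> /filter_ex[t [t0 t1]].
rewrite [(x + _)%R]addrC addrK -addrC dotvZr enormZ ?(ltW t0) //.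
rewrite (ger0_norm (mulr_ge0 (ltW t0) (enorm_ge0 _))) => wle tge.
have /(_ x x' t) := hcvx; rewrite (ltW t0) (ltW t1) => /(_ isT).
have -> : ((1 - t) *: x + t *: x' = x + t *: d)%R.
  by rewrite /d scalerBl scale1r scalerBr addrA addrAC.
have {}tge := leeD2r (half_sqnorm (x + t *: d))%:E tge.
move=> /(le_trans tge) /=; rewrite hx hx' -!EFinD lee_fin.
have -> : half_sqnorm x' = half_sqnorm (x + d) by rewrite /d subrKC.
rewrite !half_sqnormD half_sqnormZ dotvZr => main.
have wle' : (- w (x + t *: d) <= t * e)%R.
  rewrite (le_trans (ler_norm _)) // normrN (le_trans wle) //.
  rewrite mulrCA ler_wpM2l ?(ltW t0) // mulrAC ler_pdivrMr //.
  by rewrite ler_wpM2l ?(ltW e0) // lerDl.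
(* After multiplication by [t], the goal follows from [main] and [wle'], the term
   [t * t * half_sqnorm d] having the favourable sign. *)
rewrite -(ler_pM2l t0).
have q0 : (0 <= t * t * half_sqnorm d)%R.
  by rewrite mulr_ge0 ?half_sqnorm_ge0 // mulr_ge0 ?(ltW t0).
by move: main wle' q0; rewrite expr2; nra.
Unshelve. all: by end_near. Qed.

(** The inequality holds at each [xs k] with [vs k]. It passes to the limit because [h (xs k)] tends
    to [h x] and the other terms are continuous. *)
Lemma subgradient_prox_ineq h x v x' :
  (forall y, h y != -oo) -> econvex (fun y => h y + (half_sqnorm y)%:E) ->
  subgradient h x v ->
  h x + (dotv v (x' - x) - half_sqnorm (x' - x))%:E <= h x'.
Proof.
move=> hNy hcvx [hx [xs [vs [xsx hxs reg vsv]]]].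
case hx': (h x') (hNy x') => [a| |] // _; last by rewrite leey.
rewrite -(fineK hx) -EFinD lee_fin.
have dx : (x' - xs k)%R @[k --> \oo] --> (x' - x)%R.
  by apply: cvgB => //; exact: cvg_cst.
apply: (@cvgr_to_le _ \oo _ _ (fun k => fine (h (xs k)) +
  (dotv (vs k) (x' - xs k) - half_sqnorm (x' - xs k)))%R).
  apply: cvgD; first by apply: fine_cvg; rewrite fineK.
  by apply: cvgB; [exact: cvg_dotv | exact: cvg_half_sqnorm].
apply: nearW => k; have /(regular_subgradient_prox_ineq x' hNy hcvx) := reg k.
by rewrite hx' -(fineK (reg k).1) -EFinD lee_fin.
Qed.

End Subgradients.

(** * Finiteness, convexity and closed sublevel sets of the proximal average *)

Section ProximalAverage.
Context {R : realType} {n : nat}.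
Implicit Types (h : 'rV[R]_n -> \bar R) (x y : 'rV[R]_n) (l : R).

Lemma fenchel_neqNy h y : proper_fun h -> fenchel h y != -oo.
Proof.
move=> [hNy [x hx]]; rewrite -ltNye.
apply: lt_le_trans (fenchel_ge h y x).
by case: (h x) (hNy x) hx => // r _ _; rewrite -EFinB ltNyr.
Qed.

(** Equals [half_sqnorm] minus the Moreau envelope of [h] with parameter 1. *)
Definition moreau_conj h : 'rV[R]_n -> \bar R :=
  fenchel (fun z => h z + (half_sqnorm z)%:E).

Lemma moreau_conj_neqNy h y : proper_fun h -> moreau_conj h y != -oo.
Proof.
move=> [hNy [x hx]]; apply: fenchel_neqNy; split=> [z|].
  by rewrite adde_eq_ninfty negb_or hNy.
by exists x; rewrite lte_add_pinfty // ltry.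
Qed.

Lemma prox_averageE (f0 f1 : 'rV[R]_n -> \bar R) x l : (0 <= l <= 1)%R ->
  prox_average f0 f1 (x, l) = fenchel (fun y =>
    (1 - l)%:E * moreau_conj f0 y + l%:E * moreau_conj f1 y) x
    - (half_sqnorm x)%:E.
Proof. by rewrite /prox_average => ->. Qed.

Lemma prox_average_econvexD (f0 f1 : 'rV[R]_n -> \bar R) l : (0 <= l <= 1)%R ->
  econvex (fun x => prox_average f0 f1 (x, l) + (half_sqnorm x)%:E).
Proof.
move=> l01 x y t t01; rewrite !prox_averageE // !subeK //.
exact: fenchel_econvex.
Qed.

(** Otherwise, both weights being positive and neither conjugate taking the value -oo, the weighted
    sum would be +oo at every [y], and its conjugate -oo. *)
Lemma prox_average_conj_fin_num (f0 f1 : 'rV[R]_n -> \bar R) x l : (0 < l < 1)%R ->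
  proper_fun f0 -> proper_fun f1 -> prox_average f0 f1 (x, l) != -oo ->
  exists y, moreau_conj f0 y \is a fin_num /\ moreau_conj f1 y \is a fin_num.
Proof.
move=> /andP[l0 l1] p0 p1; rewrite prox_averageE ?(ltW l0) ?(ltW l1) //.
have s0 : (0 < 1 - l)%R by rewrite subr_gt0.
apply: contra_neqP => /forallNP nfin.
apply/eqP; rewrite -leeNy_eq leeBlDr // addNye.
apply: ge_ereal_sup => _ [y _ <-].
have := nfin y; rewrite !fin_numE !moreau_conj_neqNy //=.
have := moreau_conj_neqNy y p0; have := moreau_conj_neqNy y p1.
case: (moreau_conj f1 y) => [b| |] // _; case: (moreau_conj f0 y) => [a| |] // _ nab.
- by case: nab.
- by rewrite gt0_muley ?lte_fin.
- by rewrite [_ * +oo]gt0_muley ?lte_fin.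
- by rewrite !gt0_muley ?lte_fin.
Qed.

(** The term of the supremum at this one [y] is a finite lower bound for every parameter in [0, 1];
    outside, the value is +oo. *)
Lemma prox_average_neqNy (f0 f1 : 'rV[R]_n -> \bar R) y w :
  moreau_conj f0 y \is a fin_num -> moreau_conj f1 y \is a fin_num ->
  prox_average f0 f1 w != -oo.
Proof.
case: w => x l fin0 fin1; have [l01|Nl01] := boolP (0 <= l <= 1)%R; last first.
  by rewrite /prox_average (negPf Nl01).
rewrite prox_averageE // -leeNy_eq leeBlDr // addNye leeNy_eq -ltNye.
apply: lt_le_trans (fenchel_ge _ x y).
by rewrite -(fineK fin0) -(fineK fin1) -!EFinM -!EFinD ltNyr.
Qed.

(* Between 0 and 1, the [y] with an infinite conjugate do not contribute to the
   supremum defining [prox_average]. *)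
Lemma prox_average_leP (f0 f1 : 'rV[R]_n -> \bar R) x l (a : R) :
  (0 < l < 1)%R -> proper_fun f0 -> proper_fun f1 ->
  prox_average f0 f1 (x, l) <= a%:E <->
  forall y, moreau_conj f0 y \is a fin_num -> moreau_conj f1 y \is a fin_num ->
    (dotv y x - ((1 - l) * fine (moreau_conj f0 y)
      + l * fine (moreau_conj f1 y)) - half_sqnorm x <= a)%R.
Proof.
move=> /andP[l0 l1] p0 p1.
rewrite prox_averageE ?(ltW l0) ?(ltW l1) // leeBlDr //.
split=> [xa y fin0 fin1|xa].
  have := le_trans (fenchel_ge _ x y) xa.
  by rewrite -(fineK fin0) -(fineK fin1) -!EFinM -!EFinD lee_fin -lerBlDr.
have s0 : (0 < 1 - l)%R by rewrite subr_gt0.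
apply: ge_ereal_sup => _ [y _ <-].
have := moreau_conj_neqNy y p0; have := moreau_conj_neqNy y p1.
have := xa y.
case: (moreau_conj f1 y) => [b| |]; case: (moreau_conj f0 y) => [c| |] // xay _ _.
- by rewrite -!EFinM -!EFinD lee_fin -lerBlDr xay.
- rewrite gt0_muley ?lte_fin //; exact: leNye.
- rewrite [_ * +oo]gt0_muley ?lte_fin //; exact: leNye.
- rewrite !gt0_muley ?lte_fin //; exact: leNye.
Qed.

(** The contributing [y] are the same for all parameters in (0, 1), so the set is the ball
    intersected with sublevel sets of functions continuous jointly in [(x, l)]. *)
Lemma closed_prox_average_sublevel (f0 f1 : 'rV[R]_n -> \bar R)
    (w : 'rV[R]_n * R) (eps a : R) :
  proper_fun f0 -> proper_fun f1 ->
  (forall l, (`|l - w.2| <= eps)%R -> (0 < l < 1)%R) ->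
  closed [set u : 'rV[R]_n * R |
    (enorm_pair (u - w) <= eps)%R /\ prox_average f0 f1 u <= a%:E].
Proof.
move=> p0 p1 l01.
pose fin y := moreau_conj f0 y \is a fin_num /\ moreau_conj f1 y \is a fin_num.
pose g y (u : 'rV[R]_n * R) := (dotv y u.1 - ((1 - u.2) * fine (moreau_conj f0 y)
  + u.2 * fine (moreau_conj f1 y)) - half_sqnorm u.1)%R.
have gcont y : continuous (g y).
  move=> u; apply: cvgB; last by apply: cvg_half_sqnorm; exact: cvg_fst.
  apply: cvgB; first by apply: cvg_dotv; [exact: cvg_cst | exact: cvg_fst].
  apply: cvgD; (apply: cvgM; last exact: cvg_cst); last exact: cvg_snd.
  by apply: cvgB; [exact: cvg_cst | exact: cvg_snd].
rewrite (_ : [set u | _] = [set u | (enorm_pair (u - w) <= eps)%R] `&`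
    \bigcap_(y in [set y | fin y]) (g y @^-1` [set c | (c <= a)%R])).
  apply: closedI; first exact: closed_enorm_pair_ball.
  apply: closed_bigI => y _.
  by have := iffLR (continuous_closedP _) (gcont y) _ (@closed_le R a); apply.
have leP u : (enorm_pair (u - w) <= eps)%R ->
    prox_average f0 f1 u <= a%:E <-> forall y, fin y -> (g y u <= a)%R.
  move=> uw; have /l01 := le_trans (norm_snd_le_enorm_pair _) uw.
  case: u {uw} => x l /prox_average_leP/(_ p0 p1) ->.
  by split=> H y => [[]|? ?]; exact: H.
by apply/seteqP; split=> u [uw /(leP u uw)].
Qed.

End ProximalAverage.

(** * Para-prox-regularity of the proximal average *)

Theorem proposition3p6 (R : realType) (n : nat) (f0 f1 : 'rV[R]_n -> \bar R)
    (f0_proper : proper_fun f0) (f1_proper : proper_fun f1)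
    (f0_lsc : lower_semicontinuous f0) (f1_lsc : lower_semicontinuous f1)
    (f0_convex : econvex f0) (f1_convex : econvex f1)
    (lbar : R) (lbar01 : (0 < lbar < 1)%R)
    (xbar vbar : 'rV[R]_n)
    (xbar_dom : prox_average f0 f1 (xbar, lbar) < +oo)
    (vbar_sub :
      subgradient (fun x => prox_average f0 f1 (x, lbar)) xbar vbar) :
  para_prox_regular (prox_average f0 f1) xbar vbar lbar.
Proof.
have /andP[l0 l1] := lbar01.
(* Found at [lbar], this [y] does not depend on the parameter and so excludes -oo everywhere. *)
have [y [fin0 fin1]] : exists y,
    moreau_conj f0 y \is a fin_num /\ moreau_conj f1 y \is a fin_num.
  apply: (prox_average_conj_fin_num (x := xbar) (l := lbar)) => //.
  by case: vbar_sub; rewrite fin_numE => /andP[].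
(* Half the distance from [lbar] to the ends of [0, 1], so that even the closed [eps]-interval
   around [lbar] lies in (0, 1). *)
pose eps := (Num.min lbar (1 - lbar) / 2)%R.
have min0 : (0 < Num.min lbar (1 - lbar))%R by rewrite lt_min l0 subr_gt0.
have eps0 : (0 < eps)%R by rewrite divr_gt0.
have l01 l : (`|l - lbar| <= eps)%R -> (0 < l < 1)%R.
  have [] : (Num.min lbar (1 - lbar) <= lbar /\ Num.min lbar (1 - lbar) <= 1 - lbar)%R.
    by rewrite !ge_min !lexx orbT.
  rewrite /eps ler_norml => ? ? /andP[? ?]; apply/andP; split; lra.
(* With [r = 1], the quadratic term is exactly [half_sqnorm]. *)
exists eps, 1%R; split=> //; split=> //.
- split=> [w|]; first exact: prox_average_neqNy fin0 fin1.
  by exists (xbar, lbar).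
- split; first by case: vbar_sub.
  by exists eps => // a _; exact: closed_prox_average_sublevel.
- move=> x' x v l _ _ _ vsub _ /ltW/l01/andP[/ltW l_ge0 /ltW l_le1].
  rewrite div1r; apply: (subgradient_prox_ineq x' _ _ vsub) => [z|].
    exact: prox_average_neqNy fin0 fin1.
  by apply: prox_average_econvexD; rewrite l_ge0.
Qed.
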